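(* Let $n\ge1$. The absolute value measure $|\omega_n|$ on $S_n$ is a probability measure that coincides with the random power of $n$-cycle distribution, i.e. the distribution on $S_n$ of $h=g^j$, where $g$ is drawn uniformly from the $(n-1)!$ $n$-cycles of $S_n$ and, independently, $j$ is drawn uniformly from $\{1,2,\dots,n\}$.
   Context: A partition $\lambda\vdash n$ is written $[n^{m_n},\dots,2^{m_2},1^{m_1}]$, where $m_j=m_j(\lambda)$ is the number of parts equal to $j$. $C_\lambda\subset S_n$ is the conjugacy class of permutations of cycle type $\lambda$. For a function $f$ on $S_n$ and $Y\subseteq S_n$, $f(Y):=\sum_{g\in Y}f(g)$; $|f|(g):=|f(g)|$. The $m$-th necklace polynomial is $M_m(X)=\frac1m\sum_{d\mid m}\mu(d)X^{m/d}$. The cycle polynomial of $\lambda\vdash n$ is $N_\lambda(X)=\prod_{j=1}^n\binom{M_j(X)}{m_j(\lambda)}$, where $\binom{t}{k}=\frac{t(t-1)\cdots(t-k+1)}{k!}$. For $n\ge 2$ every $N_\lambda(X)$ is divisible by $X-1$, and the $1$-splitting measure on $S_n$ is the class function with $\nu_{n,1}^{\ast}(C_\lambda)=\left.\frac{N_\lambda(X)}{X^{n-1}(X-1)}\right|_{X=1}$. The measures $\omega_n$ on $S_n$ ($n\ge1$) are the class functions defined recursively by $\omega_1(C_{[1]})=1$ and, for $n\ge2$: $\omega_n(C_\lambda)=\nu_{n,1}^{\ast}(C_\lambda)$ if $\lambda=[b^a]$ with $ab=n$ and $b>1$; $\omega_n(C_{[1^n]})=\nu_{n,1}^{\ast}(C_{[1^n]})-\omega_{n-1}(C_{[1^{n-1}]})$;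 and $\omega_n(C_\lambda)=0$ for all other $\lambda$. *)

(* Defs.v *)
From mathcomp Require Import all_boot all_order all_algebra all_fingroup.

Set Implicit Arguments.
Unset Strict Implicit.
Unset Printing Implicit Defensive.

Import Order.TTheory GRing.Theory Num.Theory.
Local Open Scope ring_scope.

(* A partition of [n] is the weakly decreasing sequence of its parts, so
   [m_j(la)] is [count_mem j la] and [[b^a]] is [nseq a b]. *)

Definition cycle_type n (s : 'S_n) : seq nat :=
  sort geq [seq #|pred_of_set B| | B in porbits s].

Definition cycle_class n (la : seq nat) : {set 'S_n} :=
  [set s : 'S_n | cycle_type s == la].

Definition measure_of (T : finType) (f : T -> rat) (Y : {set T}) : rat :=
  \sum_(g in Y) f g.

Definition abs_measure (T : finType) (f : T -> rat) : T -> rat :=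
  fun g => `|f g|.

Definition is_probability (T : finType) (f : T -> rat) : Prop :=
  (forall g, 0 <= f g) /\ measure_of f [set: T] = 1.

(* The class function on S_n whose total mass on the class C_la is [v la]. *)
Definition class_measure n (v : seq nat -> rat) : 'S_n -> rat :=
  fun s => v (cycle_type s) / #|cycle_class n (cycle_type s)|%:R.

Definition moebius (d : nat) : int :=
  if all (fun p => logn p d == 1%N) (primes d) then (-1) ^+ size (primes d)
  else 0.

Definition necklace (m : nat) : {poly rat} :=
  m%:R^-1 *: \sum_(d <- divisors m) (moebius d)%:~R *: 'X^(m %/ d).

Definition binomial_poly (t : {poly rat}) (k : nat) : {poly rat} :=
  k`!%:R^-1 *: \prod_(i < k) (t - i%:R).

Definition cycle_poly (n : nat) (la : seq nat) : {poly rat} :=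
  \prod_(1 <= j < n.+1) binomial_poly (necklace j) (count_mem j la).

(* The mass is the value at 1 of the rational function
   N_la(X) / (X^(n-1) (X - 1)).  For n >= 2 the polynomial division by X - 1
   is exact; the remaining denominator X^(n-1) does not vanish at 1. *)
Definition splitting1 n : 'S_n -> rat :=
  class_measure (fun la =>
    (cycle_poly n la %/ ('X - 1%:P)).[1] / ('X^(n.-1)).[1]).

(* The value at n = 0 is a dummy: the recursion starts at n = 1. *)
Fixpoint omega (n : nat) : 'S_n -> rat :=
  match n return 'S_n -> rat with
  | 0 => fun=> 0
  | k.+1 =>
    class_measure (fun la =>
      if k == 0%N then 1
      else if [exists a : 'I_k.+2, exists b : 'I_k.+2,
                 [&& (a * b == k.+1)%N, (1 < b)%N & la == nseq a (b : nat)]]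
      then measure_of (@splitting1 k.+1) (cycle_class k.+1 la)
      else if la == nseq k.+1 1%N
      then measure_of (@splitting1 k.+1) (cycle_class k.+1 la)
           - measure_of (@omega k) (cycle_class k (nseq k 1%N))
      else 0)
  end.

Definition n_cycles (n : nat) : {set 'S_n} := cycle_class n [:: n].

Definition uniform (T : finType) (A : {set T}) : T -> rat :=
  fun x => (x \in A)%:R / #|A|%:R.

(* The exponent j in {1, ..., n} is [i.+1] for [i : 'I_n]. *)
Definition random_power n : 'S_n -> rat :=
  fun h => \sum_(g : 'S_n) \sum_(i : 'I_n)
    uniform (n_cycles n) g * uniform [set: 'I_n] i * (h == (g ^+ i.+1)%g)%:R.

(* Main.v *)
Require Import Defs.
From mathcomp Require Import all_boot all_order all_algebra all_fingroup.
From mathcomp Require Import cyclic ring.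

Set Implicit Arguments.
Unset Strict Implicit.
Unset Printing Implicit Defensive.

Import Order.TTheory GRing.Theory Num.Theory.

(** Both measures live on the rectangular cycle types [b^a] with ab = n, and
both give the class of [b^a] the mass phi(b)/n, spread evenly over the class.

Power side.  If g is an n-cycle, then all cycles of g^j have the same length
n / gcd(n, j) ([card_porbitX]), so g^j has type [b^a] exactly when
gcd(n, j) = a, which happens for phi(b) of the n exponents
([count_gcdn_totient]).  So the class of [b^a] receives mass phi(b)/n.  The
distribution is invariant under conjugation, and two permutations of the same
cycle type are conjugate ([cycle_type_conjugate]), so this mass is shared
equally by the elements of the class ([random_power_rect]).

Measure side, b > 1.  The cycle polynomial of [b^a] is binom(M_b, a).  Since
the Moebius function sums to 0 over the divisors of b, M_b(1) = 0, hence the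
cycle polynomial vanishes at 1 and the value at 1 of its quotient by X - 1 is
its derivative at 1.  In binom(t, a) the linear term at t = 0 has coefficient
(-1)^(a-1) / a, and M_b'(1) = phi(b) / b by Moebius inversion of the divisor
sum of phi.  So the mass is (-1)^(a-1) phi(b) / n ([splitting1_mass_rect]).

Measure side, b = 1.  The cycle polynomial is binom(X, n), and its quotient by
X - 1 takes at 1 the value (-1)^n / (n (n-1)).  Subtracting the mass of the
identity for n - 1, which is (-1)^(n-2) / (n-1) by induction, gives
(-1)^(n-1) / n, and phi(1) = 1 ([omega_mass_identity]).

Taking absolute values removes the signs.  The total mass is then 1 because a
random power is a probability distribution; here the existence of an n-cycle
is used ([n_cycles_neq0]). *)

(** * Orbits of powers and conjugates of a permutation *)

Lemma permX_modn (T : finType) (s : {perm T}) (x : T) (i : nat) :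
  ((s ^+ (i %% #|porbit s x|)) x = (s ^+ i) x)%g.
Proof.
set p := #|_|; rewrite [in RHS](divn_eq i p) expgD permM mulnC expgM.
congr (_ _); symmetry; elim: (i %/ p) => [|q IHq]; first by rewrite perm1.
have sp : (s ^+ p)%g x = x by rewrite permX iter_porbit.
by rewrite expgS permM sp.
Qed.

Lemma permX_eq (T : finType) (s : {perm T}) (x : T) (i j : nat) :
  (((s ^+ i) x == (s ^+ j) x)%g) = (i == j %[mod #|porbit s x|]).
Proof.
have p_gt0 : 0 < #|porbit s x| by rewrite lt0n card_porbit_neq0.
rewrite -permX_modn -[in X in _ == X]permX_modn !permX.
rewrite -(nth_uniq x _ _ (uniq_traject_porbit s x)) ?size_traject ?ltn_mod //.
by rewrite !nth_traject ?ltn_mod.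
Qed.

Lemma permX_fix (T : finType) (s : {perm T}) (x : T) (i : nat) :
  (((s ^+ i) x == x)%g) = (#|porbit s x| %| i).
Proof.
by rewrite -[X in _ == X](perm1 x) -(expg0 s) permX_eq mod0n.
Qed.

(** The power s^j acts on the cycle of x, of length p say, as translation by j
on Z/p: (s^j)^k fixes x iff p divides jk, iff p / gcd(p, j) divides k.  Both
sides of the equation are thus characterized by their multiples. *)
Lemma card_porbitX (T : finType) (s : {perm T}) (x : T) (j : nat) :
  #|porbit (s ^+ j)%g x| = #|porbit s x| %/ gcdn #|porbit s x| j.
Proof.
set p := #|porbit s x|.
have p_gt0 : 0 < p by rewrite lt0n card_porbit_neq0.
have g_gt0 : 0 < gcdn p j by rewrite gcdn_gt0 p_gt0.
have dvd_eq k : (#|porbit (s ^+ j)%g x| %| k) = (p %/ gcdn p j %| k).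
  rewrite -permX_fix -expgM permX_fix -/p.
  have -> : (p %| j * k) = (p %/ gcdn p j * gcdn p j %| j %/ gcdn p j * gcdn p j * k).
    by rewrite !divnK ?dvdn_gcdl ?dvdn_gcdr.
  rewrite [X in _ %| X]mulnAC dvdn_pmul2r // Gauss_dvdr //.
  rewrite /coprime -(eqn_pmul2r g_gt0) muln_gcdl !divnK ?dvdn_gcdl ?dvdn_gcdr //.
  by rewrite mul1n.
by apply/eqP; rewrite eqn_dvd dvd_eq dvdnn -dvd_eq dvdnn.
Qed.

Lemma porbitJ (T : finType) (s c : {perm T}) (x : T) :
  porbit (s ^ c)%g (c x) = c @: porbit s x.
Proof.
apply/setP => y; apply/porbitP/imsetP => [[i ->]|[_ /porbitP[i ->] ->]].
  by exists ((s ^+ i)%g x); rewrite ?mem_porbit // -conjXg permJ.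
by exists i; rewrite -conjXg permJ.
Qed.

Lemma partition_porbits (T : finType) (s : {perm T}) :
  partition (porbits s) [set: T].
Proof.
have -> : porbits s = preim_partition (porbit s) [set: T].
  apply/setP => B; apply/imsetP/imsetP => -[x _ ->]; exists x => //;
  by apply/setP => y; rewrite !inE eq_sym eq_porbit_mem.
exact: preim_partitionP.
Qed.

(** Equal multisets of F-values can be matched element by element; applied to
cycle lengths, this pairs the cycles of two permutations. *)
Lemma perm_eq_map_matching (T U : eqType) (F : T -> U) (r s : seq T) :
  perm_eq (map F r) (map F s) ->
  exists2 s', perm_eq s' s & map F s' = map F r.
Proof.
have [->|[x0 _]] : s = [::] \/ exists x0, x0 \in s.
- by case: s => [|x0 s0]; [left | right; exists x0; rewrite mem_head].
- by move/perm_nilP => ->; exists [::].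
move=> /(perm_iotaP (F x0)) [Is]; rewrite size_map => perm_Is ->.
exists (map (nth x0 s) Is).
  by rewrite -[X in perm_eq _ X](mkseq_nth x0) perm_map.
rewrite -map_comp; apply/eq_in_map => i /=.
by rewrite (perm_mem perm_Is) mem_iota => /= lt_i; rewrite (nth_map x0).
Qed.

(** Pair each cycle B of s with a cycle f B of t of the same length, choose a
base point in every cycle, and let c send the k-th iterate of the base point of
B to the k-th iterate of the base point of f B.  This does not depend on k,
because the lengths agree, and by construction it intertwines s and t. *)
Lemma cycle_type_conjugate n (s t : 'S_n.+1) :
  cycle_type s = cycle_type t -> exists c, (s ^ c)%g = t.
Proof.
rewrite /cycle_type => Est.
have := perm_refl (sort geq [seq #|pred_of_set B| | B in porbits s]).
rewrite [X in perm_eq _ X]Est perm_sort perm_sym perm_sort perm_sym.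
case/perm_eq_map_matching => r' perm_r' Er'.
pose f B := nth set0 r' (index B (enum (porbits s))).
have sz_r' : size r' = size (enum (porbits s)).
  by have /(congr1 size) := Er'; rewrite !size_map.
have f_idx x : index (porbit s x) (enum (porbits s)) < size r'.
  by rewrite sz_r' index_mem mem_enum imset_f.
have f_in x : f (porbit s x) \in porbits t.
  by rewrite -mem_enum -(perm_mem perm_r') mem_nth.
have card_f x : #|f (porbit s x)| = #|porbit s x|.
  have /(congr1 (nth 0 ^~ (index (porbit s x) (enum (porbits s))))) := Er'.
  rewrite !(nth_map set0) -?sz_r' // => ->.
  by rewrite nth_index // mem_enum imset_f.
have f_inj x y : f (porbit s x) = f (porbit s y) -> porbit s x = porbit s y.
  move/eqP; rewrite nth_uniq // ?(perm_uniq perm_r') ?enum_uniq //.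
  by move/eqP; apply: (index_inj set0); rewrite mem_enum imset_f.
pose rep (B : {set 'I_n.+1}) := odflt ord0 [pick y in B].
have repP (B : {set 'I_n.+1}) x : x \in B -> rep B \in B.
  by rewrite /rep; case: pickP => //= none; rewrite none.
have rep_s x : porbit s (rep (porbit s x)) = porbit s x.
  by apply/eqP; rewrite eq_porbit_mem (repP _ x) ?porbit_id.
have rep_t x : porbit t (rep (f (porbit s x))) = f (porbit s x).
  have /imsetP[y _ ->] := f_in x.
  by apply/eqP; rewrite eq_porbit_mem (repP _ y) ?porbit_id.
have [k kP] : exists k : 'I_n.+1 -> nat, forall x,
    x = (s ^+ k x)%g (rep (porbit s x)).
  apply: (@fin_all_exists _ (fun=> nat) (fun x k => x = (s ^+ k)%g (rep (porbit s x)))).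
  by move=> x; apply/porbitP; rewrite rep_s porbit_id.
(* Both sides say that i and j agree modulo the common cycle length. *)
have transfer x i j :
    ((s ^+ i) (rep (porbit s x)) == (s ^+ j) (rep (porbit s x)))%g
    = ((t ^+ i) (rep (f (porbit s x))) == (t ^+ j) (rep (f (porbit s x))))%g.
  by rewrite !permX_eq rep_s rep_t card_f.
pose c x := (t ^+ k x)%g (rep (f (porbit s x))).
have porbit_c x : porbit t (c x) = f (porbit s x) by rewrite porbit_perm rep_t.
have c_inj : injective c.
  move=> x y Exy; have Ep : porbit s x = porbit s y.
    by apply: f_inj; rewrite -!porbit_c Exy.
  move/eqP: Exy; rewrite /c -Ep -transfer => /eqP; rewrite -kP Ep -kP; exact.
exists (perm c_inj); apply/permP => y.
have [x ->] : exists x, y = perm c_inj x by exists ((perm c_inj)^-1 y)%g; rewrite permKV.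
rewrite permJ !permE.
have Ep : porbit s (s x) = porbit s x by apply: (porbit_perm s 1).
rewrite /c Ep -permM -expgSr; apply/eqP; rewrite -transfer.
by rewrite expgSr permM -kP -{1}Ep -kP.
Qed.

Lemma cycle_type_nseqP n (s : 'S_n) a b (x : 'I_n) :
  cycle_type s = nseq a b -> #|porbit s x| = b.
Proof.
move=> Es; have : #|porbit s x| \in cycle_type s.
  by rewrite mem_sort map_f // mem_enum imset_f.
by rewrite Es mem_nseq => /andP[_ /eqP].
Qed.

(** The cycles partition the n points, so equal lengths force the cycle type
to be a rectangle of area n. *)
Lemma cycle_type_rect n (s : 'S_n) b :
  (forall x, #|porbit s x| = b) ->
  cycle_type s = nseq #|porbits s| b /\ #|porbits s| * b = n.
Proof.
move=> sb; have all_b B : B \in porbits s -> #|B| = b by case/imsetP => x _ ->.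
split; last first.
  rewrite -(card_uniform_partition all_b (partition_porbits s)) cardsT.
  exact: card_ord.
have -> : #|porbits s| = size (cycle_type s) by rewrite size_sort size_map -cardE.
apply/all_pred1P; rewrite all_sort; apply/allP => _ /mapP[B B_s ->] /=.
by rewrite all_b // -mem_enum.
Qed.

(** * The n-cycles *)

Lemma n_cyclesP n (s : 'S_n) : 0 < n ->
  reflect (forall x, #|porbit s x| = n) (s \in n_cycles n).
Proof.
move=> n_gt0; rewrite inE; apply: (iffP eqP) => [Es x|/cycle_type_rect[-> /eqP]].
  exact: (@cycle_type_nseqP n s 1 n).
by rewrite -[X in _ == X]mul1n eqn_pmul2r // => /eqP ->.
Qed.

Lemma n_cycles_neq0 n : 0 < n -> 0 < #|n_cycles n|.
Proof.
case: n => // n _; apply/card_gt0P; exists (perm (@ordS_inj n.+1)).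
have full x : porbit (perm (@ordS_inj n.+1)) x = setT.
  apply/eqP; rewrite -subTset; apply/subsetP => y _; apply/porbitP.
  (* The successor modulo n+1 goes from x to y in y + (n + 1 - x) steps. *)
  exists (y + (n.+1 - x)); apply: ord_inj.
  have E i : nat_of_ord ((perm (@ordS_inj n.+1) ^+ i)%g x) = (x + i) %% n.+1.
    elim: i => [|i IHi]; first by rewrite perm1 addn0 modn_small.
    by rewrite expgSr permM permE /= IHi -addn1 modnDml addn1 addnS.
  rewrite (E (y + (n.+1 - x))) addnCA subnKC ?(ltnW (ltn_ord x)) //.
  by rewrite modnDr modn_small.
by apply/n_cyclesP => // x; rewrite full cardsT card_ord.
Qed.

(** * Divisor sums of the Moebius function *)

Lemma moebius_mul_prime (p d : nat) : prime p -> 0 < d ->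
  moebius (p * d) = if p %| d then 0%R else (- moebius d)%R.
Proof.
move=> p_pr d_gt0; have p_gt0 := prime_gt0 p_pr.
have pd_gt0 : 0 < p * d by rewrite muln_gt0 p_gt0.
have [p_d|p'd] := boolP (p %| d).
  rewrite /moebius ifN //; apply/allPn; exists p.
    by rewrite mem_primes p_pr pd_gt0 dvdn_mulr.
  rewrite lognM // (logn_prime _ p_pr) eqxx add1n eqSS -lt0n logn_gt0.
  by rewrite mem_primes p_pr d_gt0.
have p'ps : p \notin primes d by rewrite mem_primes (negPf p'd) !andbF.
have primes_pd : perm_eq (primes (p * d)) (p :: primes d).
  apply: uniq_perm; rewrite /= ?primes_uniq ?p'ps // => q.
  by rewrite primesM // primes_prime // inE [q \in p :: _]inE.
rewrite /moebius (perm_all _ primes_pd) (perm_size primes_pd) /=.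
rewrite lognM // (logn_prime _ p_pr) eqxx (eqP (_ : logn p d == 0)); last first.
  by rewrite -leqn0 leqNgt logn_gt0.
have -> : all (fun q => logn q (p * d) == 1) (primes d)
          = all (fun q => logn q d == 1) (primes d).
  apply: eq_in_all => q q_d; rewrite lognM // logn_prime; last first.
    by move: q_d; rewrite mem_primes => /andP[].
  by have /negPf-> : q != p by apply: contraNneq p'ps => <-.
by rewrite /= exprS mulN1r; case: ifP; rewrite // oppr0.
Qed.

(** Fix a prime p dividing n.  The divisors d prime to p and their multiples
p d cancel in pairs, and every other divisor is divisible by p^2. *)
Lemma sum_moebius_dvd (n : nat) : 1 < n ->
  (\sum_(d <- divisors n) moebius d = 0)%R.
Proof.
move=> n_gt1; have n_gt0 := ltnW n_gt1.
have p_pr := pdiv_prime n_gt1; have p_n := pdiv_dvd n.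
move: (pdiv n) p_pr p_n => p p_pr p_n; have p_gt0 := prime_gt0 p_pr.
have np_gt0 : 0 < n %/ p by rewrite divn_gt0 // dvdn_leq.
have dvd_pos d : d \in divisors (n %/ p) -> 0 < d.
  by rewrite -dvdn_divisors //; apply: dvdn_gt0.
rewrite (bigID (fun d => p %| d)) /=.
have -> : (\sum_(d <- divisors n | (p %| d)%N) moebius d
           = \sum_(d <- divisors (n %/ p)%N) moebius (p * d)%N)%R.
  rewrite -[LHS]big_filter -(big_map (muln p) xpredT moebius); apply: perm_big.
  apply: uniq_perm; rewrite ?filter_uniq ?divisors_uniq //.
    rewrite map_inj_uniq ?divisors_uniq // => x y /eqP.
    by rewrite eqn_pmul2l // => /eqP.
  move=> d; rewrite mem_filter -dvdn_divisors //.
  apply/andP/mapP => [[/dvdnP[e ->] ed_n]|[e]].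
    exists e; rewrite 1?mulnC // -dvdn_divisors //.
    by rewrite dvdn_divRL.
  rewrite -dvdn_divisors // => e_np ->; rewrite dvdn_mulr //.
  by rewrite mulnC -dvdn_divRL.
have -> : (\sum_(d <- divisors (n %/ p)%N) moebius (p * d)%N
           = - \sum_(d <- divisors (n %/ p) | ~~ (p %| d)%N) moebius d)%R.
  rewrite [in RHS]big_mkcond -sumrN; apply: eq_big_seq => d /dvd_pos d_gt0.
  by rewrite moebius_mul_prime //; case: ifP; rewrite //= oppr0.
rewrite -[in X in (- X)%R]big_filter -[X in (_ + X)%R]big_filter.
apply/eqP; rewrite addrC subr_eq0; apply/eqP; apply: perm_big.
apply: uniq_perm; rewrite ?filter_uniq ?divisors_uniq // => d.
rewrite !mem_filter -!dvdn_divisors //; apply: andb_id2l => p'd.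
by rewrite -[in LHS](divnK p_n) Gauss_dvdl // coprime_sym prime_coprime.
Qed.

Lemma sum_totient_divisors (n : nat) : 0 < n ->
  \sum_(d <- divisors n) totient d = n.
Proof.
move=> n_gt0; rewrite -[RHS]sum_totient_dvd.
rewrite -(big_mkord (fun d => d %| n)) -[RHS]big_filter; apply: perm_big.
apply: uniq_perm; rewrite ?filter_uniq ?divisors_uniq ?iota_uniq // => d.
rewrite mem_filter mem_index_iota -dvdn_divisors //= ltnS.
by case: (boolP (d %| n)) => // /(dvdn_leq n_gt0) ->.
Qed.

Lemma big_divisors_divn (R : nmodType) (F : nat -> R) (n d : nat) :
  0 < n -> d %| n ->
  (\sum_(e <- divisors (n %/ d)%N) F e
   = \sum_(e <- divisors n | (d * e %| n)%N) F e)%R.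
Proof.
move=> n_gt0 d_n; have d_gt0 := dvdn_gt0 n_gt0 d_n.
have nd_gt0 : 0 < n %/ d by rewrite divn_gt0 // dvdn_leq.
rewrite -[RHS]big_filter; apply: perm_big.
apply: uniq_perm; rewrite ?filter_uniq ?divisors_uniq // => e.
rewrite mem_filter -!dvdn_divisors // dvdn_divRL // mulnC.
by case: (boolP (d * e %| n)) => // /(dvdn_trans (dvdn_mull d (dvdnn e))) ->.
Qed.

(** Replace n / d by the sum of phi over its divisors and exchange the sums:
the coefficient of phi(e) becomes the sum of the Moebius function over the
divisors of n / e, which is 0 unless e = n. *)
Lemma moebius_inversion_totient (n : nat) : 0 < n ->
  (\sum_(d <- divisors n) moebius d * (n %/ d)%N%:R = (totient n)%:R)%R.
Proof.
move=> n_gt0.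
have div_gt0 d : d \in divisors n -> 0 < n %/ d.
  rewrite -dvdn_divisors // => d_n.
  by rewrite divn_gt0 ?(dvdn_gt0 n_gt0 d_n) // dvdn_leq.
transitivity (\sum_(d <- divisors n) \sum_(e <- divisors n | (d * e %| n)%N)
                moebius d * (totient e)%:R)%R.
  apply: eq_big_seq => d d_n; rewrite -{1}(sum_totient_divisors (div_gt0 d d_n)).
  rewrite natr_sum big_divisors_divn ?mulr_sumr //.
  by rewrite dvdn_divisors.
rewrite (exchange_big_dep xpredT) //=.
rewrite (bigD1_seq n) ?divisors_id ?divisors_uniq //= [X in (_ + X)%R]big1_seq.
  under eq_bigl => d do rewrite mulnC.
  by rewrite addr0 -(big_divisors_divn _ n_gt0 (dvdnn n)) divnn n_gt0 big_seq1 mul1r.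
move=> e /andP[e'n e_n]; have en : e %| n by rewrite dvdn_divisors.
under eq_bigl => d do rewrite mulnC.
rewrite -(big_divisors_divn _ n_gt0 en) -mulr_suml sum_moebius_dvd ?mul0r //.
rewrite ltn_neqAle div_gt0 // andbT eq_sym; apply: contra e'n => /eqP E1.
by rewrite -[X in _ == X](divnK en) E1 mul1n.
Qed.

Local Open Scope ring_scope.

(** * Cycle polynomials near 1 *)

Lemma necklace_at1 (m : nat) : (1 < m)%N -> (necklace m).[1] = 0.
Proof.
move=> m_gt1; rewrite /necklace hornerZ horner_sum.
under eq_bigr do rewrite hornerZ hornerXn expr1n mulr1.
by rewrite -(rmorph_sum (intmul 1)) /= sum_moebius_dvd // mulr0.
Qed.

Lemma deriv_necklace_at1 (m : nat) : (0 < m)%N ->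
  (necklace m)^`().[1] = (totient m)%:R / m%:R.
Proof.
move=> m_gt0; rewrite /necklace derivZ raddf_sum hornerZ horner_sum mulrC.
congr (_ / _); rewrite -[RHS](rmorph_nat (intmul 1)) -moebius_inversion_totient //.
rewrite rmorph_sum; apply: eq_bigr => d _.
by rewrite /= derivZ derivXn hornerZ hornerMn hornerXn expr1n rmorphM rmorph_nat.
Qed.

Lemma necklace1 : necklace 1 = 'X.
Proof. by rewrite /necklace big_seq1 invr1 !scale1r. Qed.

(** This turns the value of the exact quotient, which defines the splitting
measure, into a derivative. *)
Lemma divp_XsubC_at (R : fieldType) (p : {poly R}) (x : R) :
  p.[x] = 0 -> (p %/ ('X - x%:P)).[x] = p^`().[x].
Proof.
move/eqP/factor_theorem => [q ->]; rewrite mulpK ?polyXsubC_eq0 //.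
by rewrite derivM derivXsubC !hornerE subrr mulr0 add0r.
Qed.

Lemma binomial_poly_root (t : {poly rat}) (k : nat) (x : rat) :
  t.[x] = 0 -> (0 < k)%N -> (binomial_poly t k).[x] = 0.
Proof.
case: k => // k tx _; rewrite /binomial_poly big_ord_recl /= hornerZ hornerM.
by rewrite subr0 tx mul0r mulr0.
Qed.

(** In t (t - 1) ... (t - k + 1) / k! only the first factor vanishes at x, so
the derivative is t'(x) times the product of the values -1, ..., -(k-1) of the
others, divided by k!. *)
Lemma deriv_binomial_poly_root (t : {poly rat}) (k : nat) (x : rat) :
  t.[x] = 0 -> (0 < k)%N ->
  (binomial_poly t k)^`().[x] = (-1) ^+ k.-1 * t^`().[x] / k%:R.
Proof.
case: k => // k tx _; rewrite /binomial_poly big_ord_recl /= subr0 derivZ derivM.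
rewrite hornerZ hornerD !hornerM tx mul0r addr0 horner_prod.
have -> : \prod_(i < k) (t - (bump 0 i)%:R).[x] = (-1) ^+ k * k`!%:R.
  rewrite (eq_bigr (fun i : 'I_k => - 1 * (i.+1)%:R)).
    rewrite big_split /= prodr_const card_ord fact_prod natr_prod.
    by rewrite big_add1 big_mkord.
  by move=> i _; rewrite hornerD hornerN tx -polyC_natr hornerC sub0r mulN1r.
rewrite factS natrM invfM.
have : k`!%:R != 0 :> rat by rewrite pnatr_eq0 -lt0n fact_gt0.
have : k.+1%:R != 0 :> rat by rewrite pnatr_eq0.
by move=> k1_neq0 kf_neq0; field; rewrite nat1r k1_neq0.
Qed.

Lemma cycle_poly_rect (n a b : nat) : (0 < b <= n)%N ->
  cycle_poly n (nseq a b) = binomial_poly (necklace b) a.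
Proof.
move=> b_n; rewrite /cycle_poly (bigD1_seq b) ?iota_uniq ?mem_index_iota //=.
rewrite count_nseq /= eqxx mul1n big1 ?mulr1 // => j b'j.
by rewrite count_nseq /= eq_sym (negPf b'j) mul0n /binomial_poly big_ord0 scale1r.
Qed.

(** Here the vanishing factor at 1 is X - 1; the remaining ones take the values
1, -1, ..., -(n-2). *)
Lemma deriv_binomial_X (n : nat) : (1 < n)%N ->
  (binomial_poly 'X n).[1] = 0 /\
  (binomial_poly 'X n)^`().[1] = (-1) ^+ n / (n%:R * n.-1%:R).
Proof.
case: n => [|[|n]] // _; rewrite /binomial_poly !big_ord_recl /= subr0.
have X1 : ('X - 1).[1] = 0 :> rat by rewrite -polyC1 !hornerE subrr.
have -> : (bump 0 0)%:R = 1 :> {poly rat} by [].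
split; first by rewrite hornerZ !hornerM X1 mul0r !mulr0.
rewrite derivZ mulrCA derivM hornerZ hornerD !hornerM X1 mul0r addr0.
rewrite -polyC1 derivXsubC hornerC mul1r hornerX mul1r horner_prod.
have -> : \prod_(i < n) ('X - (bump 0 (bump 0 i))%:R).[1] = (-1) ^+ n * n`!%:R :> rat.
  rewrite (eq_bigr (fun i : 'I_n => - 1 * (i.+1)%:R)).
    rewrite big_split /= prodr_const card_ord fact_prod natr_prod.
    by rewrite big_add1 big_mkord.
  move=> i _; rewrite hornerD hornerN hornerX -polyC_natr hornerC /bump /= !add1n.
  by rewrite -addn2 -[i.+1]addn1 !natrD; ring.
have : n`!%:R != 0 :> rat by rewrite pnatr_eq0 -lt0n fact_gt0.
have : n.+1%:R != 0 :> rat by rewrite pnatr_eq0.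
have : n.+2%:R != 0 :> rat by rewrite pnatr_eq0.
rewrite !factS !natrM !exprS /=.
move: (n`!%:R : rat) (n.+1%:R : rat) (n.+2%:R : rat) => u v w w_neq0 v_neq0 u_neq0.
by field; rewrite ?u_neq0 ?v_neq0 ?w_neq0.
Qed.

(** * Masses of the splitting measure and of omega *)

Lemma class_measure_mass n (v : seq nat -> rat) (s : 'S_n) :
  measure_of (class_measure v) (cycle_class n (cycle_type s)) = v (cycle_type s).
Proof.
rewrite /measure_of (eq_bigr (fun=> v (cycle_type s) / #|cycle_class n (cycle_type s)|%:R)).
  rewrite sumr_const -[_ *+ _]mulr_natr divfK // pnatr_eq0 -lt0n.
  by apply/card_gt0P; exists s; rewrite inE.
by move=> t; rewrite inE => /eqP Et; rewrite /class_measure Et.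
Qed.

Lemma cycle_type1 n : cycle_type (1 : 'S_n)%g = nseq n 1%N.
Proof.
have fix1 x : #|porbit (1 : 'S_n)%g x| = 1%N.
  by apply/eqP; rewrite -dvdn1 -permX_fix expg1n perm1.
by have [-> Ec] := cycle_type_rect fix1; rewrite -[X in _ = nseq X _]Ec muln1.
Qed.

Lemma splitting1_mass n (s : 'S_n) : (cycle_poly n (cycle_type s)).[1] = 0 ->
  measure_of (@splitting1 n) (cycle_class n (cycle_type s))
  = (cycle_poly n (cycle_type s))^`().[1].
Proof.
move=> root1; rewrite /splitting1 class_measure_mass hornerXn expr1n divr1.
exact: divp_XsubC_at.
Qed.

Lemma splitting1_mass_rect n (s : 'S_n) (a b : nat) :
  cycle_type s = nseq a b -> (a * b = n)%N -> (0 < n)%N -> (1 < b)%N ->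
  measure_of (@splitting1 n) (cycle_class n (cycle_type s))
  = (-1) ^+ a.-1 * ((totient b)%:R / n%:R).
Proof.
move=> Es ab_n n_gt0 b_gt1; have b_gt0 := ltnW b_gt1.
have a_gt0 : (0 < a)%N by move: n_gt0; rewrite -ab_n muln_gt0 => /andP[].
have b_n : (0 < b <= n)%N by rewrite b_gt0 -ab_n leq_pmull.
rewrite splitting1_mass Es cycle_poly_rect //; last first.
  by apply: binomial_poly_root => //; apply: necklace_at1.
rewrite deriv_binomial_poly_root ?necklace_at1 // deriv_necklace_at1 //.
by rewrite -ab_n natrM invfM; ring.
Qed.

Lemma splitting1_mass_identity n : (1 < n)%N ->
  measure_of (@splitting1 n) (cycle_class n (nseq n 1%N))
  = (-1) ^+ n / (n%:R * n.-1%:R).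
Proof.
move=> n_gt1; have [root1 deriv1] := deriv_binomial_X n_gt1.
have Epoly : cycle_poly n (nseq n 1%N) = binomial_poly 'X n.
  by rewrite cycle_poly_rect ?necklace1 //= ltnW.
by rewrite -cycle_type1 splitting1_mass cycle_type1 Epoly.
Qed.

(** The mass function inside the recursive step of [omega], named so that it can
be evaluated before it is spread over the classes. *)
Definition omega_mass (k : nat) (la : seq nat) : rat :=
  if k == 0%N then 1
  else if [exists a : 'I_k.+2, exists b : 'I_k.+2,
             [&& (a * b == k.+1)%N, (1 < b)%N & la == nseq a (b : nat)]]
  then measure_of (@splitting1 k.+1) (cycle_class k.+1 la)
  else if la == nseq k.+1 1%N
  then measure_of (@splitting1 k.+1) (cycle_class k.+1 la)
       - measure_of (@omega k) (cycle_class k (nseq k 1%N))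
  else 0.

Lemma omegaE k : @omega k.+1 = class_measure (omega_mass k).
Proof. by []. Qed.

Lemma rect_existsP (k : nat) (la : seq nat) :
  reflect (exists a b, [/\ (a * b = k.+1)%N, (1 < b)%N & la = nseq a b])
    [exists a : 'I_k.+2, exists b : 'I_k.+2,
       [&& (a * b == k.+1)%N, (1 < b)%N & la == nseq a (b : nat)]].
Proof.
apply: (iffP existsP) => [[a /existsP[b /and3P[/eqP ? ? /eqP ?]]]|[a [b [ab b_gt1 ->]]]].
  by exists a, b.
have a_gt0 : (0 < a)%N by case: a ab.
have a_lt : (a < k.+2)%N by rewrite ltnS -ab leq_pmulr // ltnW.
have b_lt : (b < k.+2)%N by rewrite ltnS -ab leq_pmull.
by exists (Ordinal a_lt); apply/existsP; exists (Ordinal b_lt); rewrite /= ab b_gt1 !eqxx.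
Qed.

(** The recursion gives, with n = k + 2,
(-1)^n / (n (n-1)) - (-1)^n / (n-1) = (-1)^(n-1) / n. *)
Lemma omega_mass_identity k : omega_mass k (nseq k.+1 1%N) = (-1) ^+ k / k.+1%:R.
Proof.
elim: k => [|k IHk]; first by rewrite /omega_mass /= divr1.
rewrite /omega_mass ifN; last first.
  (* All parts of a rectangle with b > 1 exceed 1. *)
  apply/rect_existsP => -[[|a] [b [// _ b_gt1 [Eb _]]]]; by rewrite -Eb in b_gt1.
rewrite eqxx splitting1_mass_identity // omegaE.
rewrite -[nseq k.+1 1%N]cycle_type1 class_measure_mass cycle_type1 IHk !exprS.
have : k.+1%:R != 0 :> rat by rewrite pnatr_eq0.
have : k.+2%:R != 0 :> rat by rewrite pnatr_eq0.
rewrite /= -(natr1 k.+1); move: (k.+1%:R : rat) => v v1_neq0 v_neq0.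
by field; rewrite ?v_neq0 ?v1_neq0.
Qed.

Lemma omega_mass_rect k (s : 'S_k.+1) (a b : nat) :
  cycle_type s = nseq a b -> (a * b = k.+1)%N ->
  `|omega_mass k (cycle_type s)| = (totient b)%:R / k.+1%:R.
Proof.
move=> Es ab.
have norm_sign (i : nat) (x : rat) : 0 <= x -> `|(-1) ^+ i * x| = x.
  by move=> x_ge0; rewrite normrM normrX normrN1 expr1n mul1r ger0_norm.
have b_gt0 : (0 < b)%N by move: (ltn0Sn k); rewrite -ab muln_gt0 => /andP[].
have [b_gt1 | b_le1] := ltnP 1 b; last first.
  have b1 : b = 1%N by apply/eqP; rewrite eqn_leq b_le1.
  rewrite Es b1; move: ab; rewrite b1 muln1 => ->.
  by rewrite omega_mass_identity norm_sign ?invr_ge0 ?ler0n // mul1r.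
have k_neq0 : k != 0%N.
  have a_gt0 : (0 < a)%N by case: a ab {Es}.
  by rewrite -lt0n -ltnS -ab (leq_trans b_gt1) // leq_pmull.
rewrite /omega_mass (negPf k_neq0) ifT; last by apply/rect_existsP; exists a, b.
by rewrite (splitting1_mass_rect Es ab) // norm_sign // divr_ge0 ?ler0n.
Qed.

Lemma omega_mass_not_rect k (s : 'S_k.+1) :
  (forall a b, cycle_type s != nseq a b) -> omega_mass k (cycle_type s) = 0.
Proof.
move=> not_rect; rewrite /omega_mass; case: eqP => [k0|_].
  rewrite k0 in s not_rect *; have := not_rect 1%N 1%N.
  have -> : s = 1%g by apply/permP => x; rewrite !ord1.
  by rewrite cycle_type1 eqxx.
rewrite ifN; last first.
  by apply/rect_existsP => -[a [b [_ _ Es]]]; have := not_rect a b; rewrite Es eqxx.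
by rewrite (negPf (not_rect _ _)).
Qed.

(** * The random power of an n-cycle *)

Lemma random_powerE n (h : 'S_n) :
  @random_power n h = \sum_(i < n) (\sum_(g in n_cycles n | (g ^+ i.+1)%g == h) 1)
                        / (#|n_cycles n|%:R * n%:R).
Proof.
rewrite /random_power exchange_big /=; apply: eq_bigr => i _.
rewrite big_mkcondr /= [in RHS]big_mkcond mulr_suml; apply: eq_bigr => g _.
rewrite /uniform cardsT card_ord in_setT (eq_sym h) invfM.
by case: (g \in n_cycles n) => /=; case: eqP => _; rewrite ?mul1r ?mulr1 ?mul0r ?mulr0.
Qed.

Lemma n_cyclesJ n (g c : 'S_n) : (0 < n)%N ->
  ((g ^ c)%g \in n_cycles n) = (g \in n_cycles n).
Proof.
move=> n_gt0; apply/n_cyclesP/n_cyclesP => // gn x.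
  by rewrite -[RHS](gn (c x)) porbitJ card_imset //; apply: perm_inj.
by rewrite -(permKV c x) porbitJ card_imset //; apply: perm_inj.
Qed.

Lemma random_powerJ n (h c : 'S_n) : (0 < n)%N ->
  @random_power n (h ^ c)%g = @random_power n h.
Proof.
move=> n_gt0; rewrite !random_powerE; apply: eq_bigr => i _; congr (_ / _).
rewrite (reindex_inj (conjg_inj c)); apply: eq_bigl => g.
by rewrite n_cyclesJ // -conjXg (inj_eq (conjg_inj c)).
Qed.

Lemma random_power_class n (h h' : 'S_n) : (0 < n)%N ->
  cycle_type h = cycle_type h' -> @random_power n h = @random_power n h'.
Proof.
case: n h h' => // n h h' _ /cycle_type_conjugate[c <-].
by rewrite random_powerJ.
Qed.

Lemma random_power_mass n (A : {set 'S_n}) :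
  \sum_(h in A) @random_power n h
  = \sum_(i < n) #|[set g in n_cycles n | (g ^+ i.+1)%g \in A]|%:R
      / (#|n_cycles n|%:R * n%:R).
Proof.
under eq_bigr do rewrite random_powerE.
rewrite exchange_big /=; apply: eq_bigr => i _.
rewrite -mulr_suml; congr (_ / _).
rewrite (exchange_big_dep (mem (n_cycles n))) /=; last by move=> h g _ /andP[].
rewrite -sum1_card natr_sum.
rewrite [RHS](eq_bigl (fun g => (g \in n_cycles n) && ((g ^+ i.+1)%g \in A))); last first.
  by move=> g; rewrite in_set.
rewrite [RHS]big_mkcondr; apply: eq_bigr => g g_n; case: ifP => g_A.
  rewrite (big_pred1 (g ^+ i.+1)%g) // => h; rewrite g_n /= eq_sym.
  by case: eqP => [->|_]; rewrite ?g_A ?andbF.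
rewrite big_pred0 // => h; rewrite g_n /=.
by case: eqP => [<-|_]; rewrite ?g_A ?andbF.
Qed.


(** The exponents j in {1, ..., n} with gcd(n, j) = a are the multiples
j = a d with d in {1, ..., b} prime to b. *)
Lemma count_gcdn_totient (n a b : nat) : (a * b = n)%N -> (0 < n)%N ->
  #|[set i : 'I_n | gcdn n i.+1 == a]| = totient b.
Proof.
move=> ab n_gt0.
have /andP[a_gt0 b_gt0] : (0 < a)%N && (0 < b)%N by rewrite -muln_gt0 ab.
have -> : totient b = size [seq d <- index_iota 1 b.+1 | coprime b d].
  rewrite totient_count_coprime -sum1_size big_filter.
  (* The totient counts over {0, ..., b-1} and the list over {1, ..., b}; the
     end terms match since gcd(b, 0) = gcd(b, b). *)
  rewrite [RHS]big_mkcond [RHS]big_nat_recr //= big_ltn // addnC.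
  by rewrite /coprime gcdn0 gcdnn.
have -> : #|[set i : 'I_n | gcdn n i.+1 == a]|
    = size [seq j <- index_iota 1 n.+1 | gcdn n j == a].
  rewrite -sum1_card -sum1_size big_filter big_add1 big_mkord.
  by apply: eq_bigl => i; rewrite inE.
rewrite -[RHS](size_map (muln a)); apply: perm_size.
apply: uniq_perm; rewrite ?filter_uniq ?iota_uniq //.
  rewrite map_inj_uniq ?filter_uniq ?iota_uniq // => x y /eqP.
  by rewrite eqn_pmul2l // => /eqP.
have gcd_a d : (gcdn n (a * d) == a) = coprime b d.
  by rewrite -ab -muln_gcdr -[X in _ == X]muln1 eqn_pmul2l.
move=> j; rewrite mem_filter mem_index_iota; apply/andP/mapP => [[/eqP gcd_j j_n]|[d]].
  have /dvdnP[d Ej] : (a %| j)%N by rewrite -gcd_j dvdn_gcdr.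
  exists d; last by rewrite mulnC.
  rewrite mem_filter mem_index_iota -gcd_a mulnC -Ej gcd_j eqxx /=.
  move: j_n; rewrite Ej muln_gt0 !ltnS -ab [(a * b)%N]mulnC leq_pmul2r //.
  by rewrite a_gt0 andbT.
rewrite mem_filter mem_index_iota ltnS => /and3P[co_bd d_gt0 d_b] ->.
by rewrite gcd_a co_bd ltnS -ab leq_pmul2l // muln_gt0 a_gt0 d_gt0 d_b.
Qed.

Lemma card_porbit_n_cycleX n (g : 'S_n) (x : 'I_n) (j : nat) :
  g \in n_cycles n -> #|porbit (g ^+ j)%g x| = (n %/ gcdn n j)%N.
Proof.
have n_gt0 : (0 < n)%N by apply: leq_ltn_trans (ltn_ord x).
by move/(n_cyclesP _ n_gt0) => gn; rewrite card_porbitX gn.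
Qed.

Lemma cycle_type_n_cycleX n (g : 'S_n) (j a b : nat) : (0 < n)%N ->
  (a * b = n)%N -> g \in n_cycles n ->
  (cycle_type (g ^+ j)%g == nseq a b) = (gcdn n j == a).
Proof.
move=> n_gt0 ab g_n.
have /andP[a_gt0 b_gt0] : (0 < a)%N && (0 < b)%N by rewrite -muln_gt0 ab.
have gcd_gt0 : (0 < gcdn n j)%N by rewrite gcdn_gt0 n_gt0.
have [Et Ec] := cycle_type_rect (fun x => card_porbit_n_cycleX x j g_n).
have Ed : #|porbits (g ^+ j)%g| = gcdn n j.
  apply/eqP; rewrite -(eqn_pmul2r (_ : 0 < n %/ gcdn n j)%N).
    by rewrite Ec mulnC divnK ?dvdn_gcdl.
  by rewrite divn_gt0 // dvdn_leq ?dvdn_gcdl.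
rewrite Et Ed; apply/eqP/eqP => [/(congr1 size)|->]; first by rewrite !size_nseq.
by rewrite -ab mulKn.
Qed.

(** It suffices to compute the mass of the whole class, since the distribution
is constant on it.  For a given exponent j, either every n-cycle g has g^j in
the class or none has, according to whether gcd(n, j) = a; so each of the
phi(b) good exponents contributes 1/n. *)
Lemma random_power_rect n (h : 'S_n) (a b : nat) : (0 < n)%N ->
  cycle_type h = nseq a b -> (a * b = n)%N ->
  @random_power n h
  = (totient b)%:R / n%:R / #|cycle_class n (cycle_type h)|%:R.
Proof.
move=> n_gt0 Eh ab; set C := cycle_class _ _.
have C_neq0 : #|C|%:R != 0 :> rat.
  by rewrite pnatr_eq0 -lt0n; apply/card_gt0P; exists h; rewrite inE.
have N_neq0 : #|n_cycles n|%:R != 0 :> rat by rewrite pnatr_eq0 -lt0n n_cycles_neq0.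
apply/(canRL (mulfK C_neq0)); rewrite mulr_natr -sumr_const.
rewrite (eq_bigr (@random_power n)); last first.
  by move=> s; rewrite inE => /eqP Es; apply: random_power_class.
rewrite random_power_mass (eq_bigr (fun i : 'I_n => if gcdn n i.+1 == a then n%:R^-1 else 0)).
  rewrite -big_mkcond sumr_const /= -(count_gcdn_totient ab n_gt0) mulr_natl.
  by congr (_ *+ _); apply: eq_card => i; rewrite inE.
move=> i _; have -> : [set g in n_cycles n | (g ^+ i.+1)%g \in C]
    = if gcdn n i.+1 == a then n_cycles n else set0.
  apply/setP => g; rewrite in_set (fun_if (fun A : {set 'S_n} => g \in A)) in_set0.
  have [g_n|g'n] := boolP (g \in n_cycles n); last by case: ifP.
  by rewrite /C /cycle_class in_set Eh cycle_type_n_cycleX //; case: ifP.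
case: ifP => _; last by rewrite cards0 mul0r.
by rewrite invfM mulrA divff // mul1r.
Qed.

Lemma random_power_not_rect n (h : 'S_n) : (0 < n)%N ->
  (forall a b, cycle_type h != nseq a b) -> @random_power n h = 0.
Proof.
move=> n_gt0 not_rect; rewrite random_powerE big1 // => i _.
rewrite big_pred0 ?mul0r // => g; apply/andP => -[g_n /eqP Eh].
have [Et _] := cycle_type_rect (fun x => card_porbit_n_cycleX x i.+1 g_n).
by have := not_rect #|porbits h| (n %/ gcdn n i.+1)%N; rewrite -Eh Et eqxx.
Qed.

Lemma random_power_total n : (0 < n)%N ->
  measure_of (@random_power n) [set: 'S_n] = 1.
Proof.
move=> n_gt0; rewrite /measure_of random_power_mass.
have N_neq0 : #|n_cycles n|%:R != 0 :> rat by rewrite pnatr_eq0 -lt0n n_cycles_neq0.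
have n_neq0 : n%:R != 0 :> rat by rewrite pnatr_eq0 -lt0n.
rewrite (eq_bigr (fun=> n%:R^-1)).
  by rewrite sumr_const card_ord -[_ *+ _]mulr_natr mulVf.
move=> i _; have -> : [set g in n_cycles n | (g ^+ i.+1)%g \in [set: 'S_n]] = n_cycles n.
  by apply/setP => g; rewrite in_set in_setT andbT.
by rewrite invfM mulrA divff // mul1r.
Qed.

(** * The absolute value of omega *)

Lemma abs_omega_random_power n (h : 'S_n) : (0 < n)%N ->
  `|@omega n h| = @random_power n h.
Proof.
case: n h => // k h _; rewrite omegaE /class_measure normrM normfV normr_nat.
have [is_rect|not_rect] :=
  boolP [forall x, #|porbit h x| == #|porbit h ord0|].
  have [Eh ab] := cycle_type_rect (fun x => eqP (forallP is_rect x)).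
  by rewrite (omega_mass_rect Eh ab) (random_power_rect _ Eh ab).
have {}not_rect a b : cycle_type h != nseq a b.
  apply: contra not_rect => /eqP Eh; apply/forallP => x.
  by rewrite !(cycle_type_nseqP _ Eh).
by rewrite omega_mass_not_rect // random_power_not_rect // normr0 mul0r.
Qed.

Theorem theorem4p1 (n : nat) (hn : (1 <= n)%N) :
  is_probability (abs_measure (@omega n)) /\
  (forall h : 'S_n, abs_measure (@omega n) h = @random_power n h).
Proof.
have E h : abs_measure (@omega n) h = @random_power n h.
  exact: abs_omega_random_power.
split=> //; split=> [g|]; first exact: normr_ge0.
by rewrite -(random_power_total hn); apply: eq_bigr => g _; apply: E.
Qed.
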